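(* Let $p$ be a prime with $p\ne 3$, let $q=p^k$ where $k$ is a positive integer, and let $Q,R,S\in\{p^i : i\ge 0\}$. Let $\omega\in\mathbb{F}_{q^2}^*$ be an element of multiplicative order $3$, and let $r$ be a positive integer such that $r\equiv Q+R+S\pmod{q+1}$. Define \begin{align*} C_1(X) := {} & (\omega^{Q+S}-\omega^{R+1}) X^{Q+R+S} + (\omega^Q-\omega^{R+S+1}) X^{Q+R} \\ & + (\omega^{Q+R+S}-\omega) X^{Q+S} + (\omega^S-\omega^{Q+R+1}) X^{R+S} \\ & + (\omega^{Q+R}-\omega^{S+1}) X^Q + (1-\omega^{Q+R+S+1}) X^R \\ & + (\omega^{R+S}-\omega^{Q+1}) X^S + (\omega^R-\omega^{Q+S+1}) \end{align*} and $C_2(X) := X^{Q+R+S} C_1(1/X)$. Let $\beta=\omega^Q-\omega^{R+S+1}$ if $Q+S\equiv R+1\pmod 3$, and $\beta=\omega^{Q+S}-\omega^{R+1}$ otherwise, and write $B_z(X) := C_z(X)/\beta$ for each $z\in\{1,2\}$. Then for each $z\in\{1,2\}$: (i) $B_z(X)$ has at most five terms, its coefficients are in $\mathbb{F}_p$, and if the integers $Q,R,S$ are pairwise distinct then the coefficients of (the terms of) $B_z(X)$ are in $\{1,-1\}$. (ii) $f(X) := X^r B_z(X^{q-1})$ permutes $\mathbb{F}_{q^2}$ if and only if $q\equiv 1\pmod 3$, $\gcd(r,q-1)=1$ and $\gcd(Q-R+S,q+1)=1$.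
   Context: A polynomial $f(X)\in\mathbb{F}_{q^2}[X]$ permutes $\mathbb{F}_{q^2}$ if the function $\alpha\mapsto f(\alpha)$ is a bijection $\mathbb{F}_{q^2}\to\mathbb{F}_{q^2}$. The ''terms'' of a polynomial are its monomials with nonzero coefficient, and the assertion that the coefficients lie in $\{1,-1\}$ refers to these nonzero coefficients (as elements of $\mathbb{F}_p$). The integer $Q-R+S$ may be zero or negative; the gcd is the usual nonnegative gcd of integers. *)

(* Defs.v *)
From mathcomp Require Import all_boot all_order all_algebra.
From mathcomp Require Import zify.

Set Implicit Arguments.
Unset Strict Implicit.
Unset Printing Implicit Defensive.

Import GRing.Theory.
Local Open Scope ring_scope.

(* 'X^N * P(1/X), as a polynomial, for P of degree at most N.  N need not be
   the exact degree of P. *)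
Definition recip_poly (F : fieldType) (N : nat) (P : {poly F}) : {poly F} :=
  \poly_(i < N.+1) P`_(N - i).

(* Evaluation in an arbitrary extension field K of F; taking for K the field of
   rational functions and for x its generator gives the polynomial identity. *)
Lemma recip_polyE (F K : fieldType) (f : {rmorphism F -> K}) (N : nat)
    (P : {poly F}) (x : K) : (size P <= N.+1)%N -> x != 0 ->
  (map_poly f (recip_poly N P)).[x] = x ^+ N * (map_poly f P).[x^-1].
Proof.
move=> sP x0.
have sR : (size (map_poly f (recip_poly N P)) <= N.+1)%N.
  by rewrite size_map_poly size_poly.
have sP' : (size (map_poly f P) <= N.+1)%N by rewrite size_map_poly.
rewrite (horner_coef_wide _ sR) (horner_coef_wide _ sP') mulr_sumr.
rewrite (reindex_inj rev_ord_inj) /=; apply: eq_bigr => i _.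
rewrite !coef_map coef_poly subSS ltnS leq_subr.
have iN : (i <= N)%N by rewrite -ltnS.
by rewrite subKn // exprVn mulrCA -expfB_cond // (negPf x0) add0n.
Qed.

Section Polynomials.

Variables (F : fieldType) (w : F) (Q R S : nat).

Definition C1 : {poly F} :=
    (w ^+ (Q + S) - w ^+ (R + 1)) *: 'X^(Q + R + S)
  + (w ^+ Q - w ^+ (R + S + 1)) *: 'X^(Q + R)
  + (w ^+ (Q + R + S) - w) *: 'X^(Q + S)
  + (w ^+ S - w ^+ (Q + R + 1)) *: 'X^(R + S)
  + (w ^+ (Q + R) - w ^+ (S + 1)) *: 'X^Q
  + (1 - w ^+ (Q + R + S + 1)) *: 'X^R
  + (w ^+ (R + S) - w ^+ (Q + 1)) *: 'X^S
  + (w ^+ R - w ^+ (Q + S + 1))%:P.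

Lemma size_C1 : (size C1 <= (Q + R + S).+1)%N.
Proof.
have sZ (a : F) n : (n <= Q + R + S)%N ->
    (size (a *: 'X^n : {poly F}) <= (Q + R + S).+1)%N.
  by move=> le_n; apply: leq_trans (size_scale_leq _ _) _; rewrite size_polyXn.
have sD (A B : {poly F}) m :
    (size A <= m)%N -> (size B <= m)%N -> (size (A + B)%R <= m)%N.
  by move=> hA hB; apply: leq_trans (size_polyD _ _) _; rewrite geq_max hA.
rewrite /C1; apply: (sD); last exact: leq_trans (size_polyC_leq1 _) _.
by do 6?[apply: (sD); last by apply: sZ; lia]; apply: sZ; lia.
Qed.

(* By recip_polyE and size_C1, this is 'X^(Q + R + S) * C1(1/X). *)
Definition C2 : {poly F} := recip_poly (Q + R + S) C1.

Definition beta : F :=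
  if (Q + S == R + 1 %[mod 3])%N then w ^+ Q - w ^+ (R + S + 1)
  else w ^+ (Q + S) - w ^+ (R + 1).

End Polynomials.

Definition nb_terms (F : fieldType) (P : {poly F}) : nat :=
  count (fun c => c != 0) P.

(* Membership in the prime subfield of a field of characteristic p, that is, in
   the image of 'F_p. *)
Definition in_prime_field (p : nat) (F : fieldType) (c : F) : Prop :=
  exists a : 'F_p, c = (nat_of_ord a)%:R.

Definition permutes (F : finFieldType) (f : {poly F}) : Prop :=
  bijective (fun x : F => f.[x]).

(* Main.v *)
Require Import Defs.
From mathcomp Require Import all_boot all_order all_algebra.
From mathcomp Require Import cyclic finfield.
From mathcomp Require Import zify ring.

(* Put U = wX + 1, V = X + w and mu = the (q+1)-st roots of unity.  Since Q, R, S
   are powers of the characteristic, C1 = U^Q V^R U^S - w V^Q U^R V^S, and C2 is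
   obtained by exchanging U and V.  The coefficients of C1 are w^i - w^j with
   i + j constant mod 3, hence each is 0, beta or -beta, and three of them
   vanish.

   The polynomial f permutes F iff r is prime to q - 1 and
   g = x^r B(x)^(q-1) is injective on mu (when B has no root in mu).
   If q = 1 mod 3, then psi = U/V permutes mu and g is psi^-1 o X^(Q-R+S) o psi
   or its inverse.  If q = 2 mod 3, then -w is an element of mu and a root of
   both C1 and C2, so f has a nonzero root. *)

Set Implicit Arguments.
Unset Strict Implicit.
Unset Printing Implicit Defensive.

Import GRing.Theory.
Local Open Scope ring_scope.

(** * Polynomials given by lists of terms *)

Section SparsePoly.

Variable F : fieldType.
Implicit Types (L : seq (F * nat)) (P : {poly F}).

(** Repeated exponents and zero coefficients are allowed, so coincidences among Q, R, S need no case
    analysis. *)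
Definition poly_of_terms L : {poly F} := \sum_(m <- L) m.1 *: 'X^(m.2).

Lemma coef_poly_of_terms L i :
  (poly_of_terms L)`_i = \sum_(m <- L | m.2 == i) m.1.
Proof.
rewrite coef_sum [RHS]big_mkcond; apply: eq_bigr => m _.
by rewrite coefZ coefXn eq_sym; case: eqP; rewrite ?mulr1 ?mulr0.
Qed.

Lemma nb_terms_sum P N :
  (size P <= N)%N -> nb_terms P = (\sum_(i < N) (P`_i != 0)%R)%N.
Proof.
move=> sP; rewrite /nb_terms -sum1_count big_mkcond (big_nth 0) big_mkord.
rewrite (big_ord_widen N (fun i => if P`_i != 0 then 1%N else 0%N) sP).
rewrite big_mkcond; apply: eq_bigr => i _ /=.
by case: ltnP => [_|le_i]; [case: ifP | rewrite nth_default ?eqxx].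
Qed.

(** Adding a monomial alters a single coefficient, so it creates at most one new term. *)
Lemma nb_terms_poly_of_terms L :
  (nb_terms (poly_of_terms L) <= count (fun m => m.1 != 0)%R L)%N.
Proof.
elim: L => [|m L IH]; rewrite /poly_of_terms ?big_nil ?big_cons /=.
  by rewrite /nb_terms polyseq0.
have [N sN] : exists N, (size (poly_of_terms L) <= N)%N /\ (m.2 < N)%N.
  exists (maxn (size (poly_of_terms L)) m.2.+1).
  by rewrite leq_maxl leq_maxr.
case: sN => sL mN; rewrite -/(poly_of_terms L).
have sm : (size (m.1 *: 'X^(m.2) : {poly F}) <= N)%N.
  by apply: leq_trans (size_scale_leq _ _) _; rewrite size_polyXn.
rewrite (@nb_terms_sum _ N); last first.
  by apply: leq_trans (size_polyD _ _) _; rewrite geq_max sm.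
apply: leq_trans (leq_add (leqnn _) IH); rewrite (nb_terms_sum sL).
apply: (@leq_trans (\sum_(i < N) ((i == m.2 :> nat) && (m.1 != 0)%R
    + ((poly_of_terms L)`_i != 0)%R))%N).
  apply: leq_sum => i _; rewrite coefD coefZ coefXn.
  case: (nat_of_ord i =P m.2) => _ /=; last by rewrite mulr0 add0r.
  rewrite mulr1; have [->|_] := eqVneq m.1 0; first by rewrite add0r.
  by case: (_ + _ == 0).
rewrite big_split leq_add2r (bigD1 (Ordinal mN)) //= eqxx /= big1 ?addn0 //.
by move=> i; rewrite -val_eqE /= => /negPf->.
Qed.

Lemma coef_poly_of_uniq_terms L i : uniq [seq m.2 | m <- L] ->
  (poly_of_terms L)`_i != 0 -> (poly_of_terms L)`_i \in [seq m.1 | m <- L].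
Proof.
rewrite coef_poly_of_terms; elim: L => [|m L IH] /=.
  by rewrite big_nil eqxx.
case/andP=> mL uL; rewrite big_cons; case: (m.2 =P i) => [mi|_]; last first.
  by move=> nz; have := IH uL nz; rewrite inE orbC => ->.
rewrite big_seq_cond big1 ?addr0 ?inE ?eqxx // => a /andP[aL /eqP ai].
by case/negP: mL; rewrite mi -ai map_f.
Qed.

Lemma recip_poly_of_terms N L : all (fun m => m.2 <= N)%N L ->
  recip_poly N (poly_of_terms L)
  = poly_of_terms [seq (m.1, (N - m.2)%N) | m <- L].
Proof.
move=> /allP LN; apply/polyP=> i; rewrite coef_poly !coef_poly_of_terms.
rewrite big_map /=; case: ltnP => iN; last first.
  by rewrite big1 // => m /eqP mi; move: iN; rewrite -mi; lia.
rewrite big_seq_cond [RHS]big_seq_cond; apply: eq_bigl => m.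
case mL : (m \in L) => //=; move: (LN m mL) => mN.
by apply/eqP/eqP; lia.
Qed.

End SparsePoly.

(** * Coefficients as differences of powers of a cube root of unity *)

Section Coefficients.

Variables (F : fieldType) (w : F).
Hypothesis w3 : 3.-primitive_root w.

Lemma expr3n_eq i j : i = j %[mod 3] -> w ^+ i = w ^+ j.
Proof. by move=> ij; apply/eqP; rewrite (eq_prim_root_expr w3); apply/eqP. Qed.

(* An unordered pair of distinct residues mod 3 is determined by its sum. *)
Lemma root3_diff i j i' j' : i + j = i' + j' %[mod 3] -> i <> j %[mod 3] ->
  i' <> j' %[mod 3] ->
  w ^+ i - w ^+ j = w ^+ i' - w ^+ j' \/
  w ^+ i - w ^+ j = - (w ^+ i' - w ^+ j').
Proof.
move=> eqs ij ij'; have [ii|ii] : i = i' %[mod 3] \/ i = j' %[mod 3] by lia.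
  by left; rewrite (expr3n_eq ii) (@expr3n_eq j j') //; lia.
by right; rewrite opprB (expr3n_eq ii) (@expr3n_eq j i') //; lia.
Qed.

(* An entry [((i, j), e)] stands for the term [(w ^+ i - w ^+ j) *: 'X^e]. *)
Definition C1_exps (Q R S : nat) : seq ((nat * nat) * nat) :=
  [:: ((Q + S, R + 1), Q + R + S); ((Q, R + S + 1), Q + R);
      ((Q + R + S, 1), Q + S); ((S, Q + R + 1), R + S);
      ((Q + R, S + 1), Q); ((0, Q + R + S + 1), R);
      ((R + S, Q + 1), S); ((R, Q + S + 1), 0)]%N.

Definition diff_term (m : (nat * nat) * nat) : F * nat :=
  (w ^+ m.1.1 - w ^+ m.1.2, m.2).

Lemma C1_terms Q R S :
  C1 w Q R S = poly_of_terms (map diff_term (C1_exps Q R S)).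
Proof.
rewrite /poly_of_terms big_map /C1_exps !big_cons big_nil /= addr0.
by rewrite !addrA !expr1 !expr0 alg_polyC /C1.
Qed.

Lemma C2_terms Q R S : C2 w Q R S =
  poly_of_terms
    [seq ((diff_term m).1, (Q + R + S - m.2)%N) | m <- C1_exps Q R S].
Proof.
rewrite /C2 C1_terms recip_poly_of_terms -?map_comp //.
by rewrite all_map /=; apply/and5P; split; rewrite ?andbT; lia.
Qed.

Section Residues.

Variables Q R S : nat.
Hypotheses (Q3 : ~~ (3 %| Q)%N) (R3 : ~~ (3 %| R)%N) (S3 : ~~ (3 %| S)%N).

Let bi := (if (Q + S == R + 1 %[mod 3])%N then Q else Q + S)%N.
Let bj := (if (Q + S == R + 1 %[mod 3])%N then R + S + 1 else R + 1)%N.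

Lemma beta_diff : beta w Q R S = w ^+ bi - w ^+ bj.
Proof. by rewrite /beta /bi /bj; case: ifP. Qed.

(** The case split in [beta] avoids a zero value: if both candidate differences vanished, 3 would
    divide 2S. *)
Lemma beta_exps : bi + bj = Q + R + S + 1 %[mod 3] /\ bi <> bj %[mod 3].
Proof. by rewrite /bi /bj; case: eqP; lia. Qed.

Lemma diff_eq0 i j : (w ^+ i - w ^+ j == 0) = (i == j %[mod 3])%N.
Proof. by rewrite subr_eq0 (eq_prim_root_expr w3). Qed.

Lemma beta_neq0 : beta w Q R S != 0.
Proof. by rewrite beta_diff diff_eq0; apply/eqP; case: beta_exps. Qed.

(** Each pair distributes the summands Q, R, S, 1 over its two exponents. *)
Lemma C1_exps_sum m : m \in C1_exps Q R S ->
  m.1.1 + m.1.2 = Q + R + S + 1 %[mod 3].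
Proof.
by rewrite /C1_exps !inE;
  do 7?[case/orP=> [/eqP->|] /=; first lia]; move=> /eqP-> /=; lia.
Qed.

Lemma C1_coef m : m \in C1_exps Q R S -> let c := (diff_term m).1 in
  [\/ c = 0, c = beta w Q R S | c = - beta w Q R S].
Proof.
move=> mC /=; have [/eqP|] := boolP (m.1.1 == m.1.2 %[mod 3])%N.
  by move=> /expr3n_eq->; constructor 1; rewrite subrr.
move/eqP=> neq; rewrite beta_diff; case: beta_exps => eqs bneq.
have /root3_diff/(_ neq bneq) : m.1.1 + m.1.2 = bi + bj %[mod 3].
  by rewrite eqs C1_exps_sum.
by case=> ->; [constructor 2 | constructor 3].
Qed.

(* For each term, the difference of the two exponents of [w] is a signed sum of
   Q, R, S and 1, and up to a global sign the eight terms run over all sign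
   patterns.  Each of Q, R, S, 1 is 1 or -1 mod 3, so such a sum of four signs
   vanishes mod 3 exactly when it has two signs of each kind: this happens for
   three of the eight patterns. *)
Lemma C1_exps_count :
  count (fun m => (diff_term m).1 != 0) (C1_exps Q R S) = 5%N.
Proof.
rewrite /C1_exps /= !diff_eq0.
have: (Q %% 3 = 1 \/ Q %% 3 = 2)%N by lia.
have: (R %% 3 = 1 \/ R %% 3 = 2)%N by lia.
have: (S %% 3 = 1 \/ S %% 3 = 2)%N by lia.
by move=> [] hS [] hR [] hQ;
  repeat match goal with |- context [(?x %% 3 == ?y %% 3)%N] =>
    first [have -> : (x %% 3 == y %% 3)%N by apply/eqP; lia
          |have -> : (x %% 3 == y %% 3)%N = false by apply/negbTE/eqP; lia] end.
Qed.

End Residues.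

End Coefficients.

(** * Prime-field coefficients and distinctness of the exponents *)

Section PrimeField.

Variables (p : nat) (F : fieldType).
Hypotheses (p_prime : prime p) (pF : p \in [pchar F]).

Lemma in_prime_field_nat n : in_prime_field p (n%:R : F).
Proof.
by exists n%:R; rewrite val_Fp_nat // GRing.natr_mod_pchar.
Qed.

Lemma in_prime_fieldD (a b : F) :
  in_prime_field p a -> in_prime_field p b -> in_prime_field p (a + b).
Proof. by case=> a' -> [b' ->]; rewrite -natrD; apply: in_prime_field_nat. Qed.

Lemma in_prime_fieldN1 : in_prime_field p (-1 : F).
Proof.
have -> : -1 = p.-1%:R :> F; last exact: in_prime_field_nat.
apply/eqP; rewrite eq_sym -addr_eq0 natr1 prednK ?prime_gt0 //.
by rewrite (pcharf0 pF).
Qed.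

End PrimeField.

(** After division by [b] the listed coefficients are 0, 1 or -1. Where exponents coincide they add
    up inside the prime field; with distinct exponents nothing is added. *)
Lemma scaled_terms (F : fieldType) (b : F) L : b != 0 ->
    (forall m, m \in L -> [\/ m.1 = 0, m.1 = b | m.1 = - b]) ->
  let B := b^-1 *: poly_of_terms L in
  [/\ (nb_terms B <= count (fun m => m.1 != 0)%R L)%N,
      forall p, prime p -> p \in [pchar F] ->
        forall i, in_prime_field p B`_i
    & uniq [seq m.2 | m <- L] -> forall i, B`_i != 0 -> B`_i = 1 \/ B`_i = -1].
Proof.
move=> b0 Lb B.
have eB : B = poly_of_terms [seq (b^-1 * m.1, m.2) | m <- L].
  rewrite /B /poly_of_terms big_map scaler_sumr.
  by apply: eq_bigr => m _; rewrite scalerA.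
have Lb' m : m \in L -> [\/ b^-1 * m.1 = 0, b^-1 * m.1 = 1 | b^-1 * m.1 = -1].
  case/Lb=> ->; [constructor 1|constructor 2|constructor 3].
  - by rewrite mulr0.
  - by rewrite mulVf.
  by rewrite mulrN mulVf.
split=> [|p p_pr pF i|uL i].
- rewrite eB (leq_trans (nb_terms_poly_of_terms _)) // count_map.
  apply: eq_leq; apply: eq_count => m /=.
  by rewrite mulf_eq0 invr_eq0 (negPf b0).
- rewrite eB coef_poly_of_terms big_map big_seq_cond.
  apply: (big_ind (@in_prime_field p F)) => [|x y|m /andP[mL _]].
  + exact: (in_prime_field_nat p_pr pF 0).
  + exact: in_prime_fieldD.
  case: (Lb' _ mL) => /= ->.
  + exact: (in_prime_field_nat p_pr pF 0).
  + exact: (in_prime_field_nat p_pr pF 1).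
  exact: in_prime_fieldN1.
have uL' : uniq [seq m.2 | m <- [seq (b^-1 * m.1, m.2) | m <- L]].
  by rewrite -map_comp.
rewrite eB => nz; have := coef_poly_of_uniq_terms uL' nz.
rewrite -map_comp => /mapP[m mL em]; rewrite em in nz *.
by move: nz; case: (Lb' m mL) => /= ->; rewrite ?eqxx; [| left | right].
Qed.

(** If a < b, equality forces c > a, and then p ^ a.+1 would divide p ^ a. *)
Lemma prime_pow_add_neq p a b c : prime p -> (p ^ a <> p ^ b)%N ->
  (p ^ a + p ^ b <> p ^ c)%N.
Proof.
move=> p_pr; wlog ab : a b / (a <= b)%N => [wl|].
  case: (leqP a b) => [/wl//|/ltnW/wl ba ne]; rewrite addnC.
  by apply: ba; apply: nesym.
move=> ne; have {ne}ab : (a < b)%N.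
  by rewrite ltn_neqAle ab andbT; apply/eqP => e; apply: ne; rewrite e.
move=> e; have p1 := prime_gt1 p_pr.
have ac : (a < c)%N.
  rewrite -(ltn_exp2l _ _ p1) -e -[X in (X < _)%N]addn0 ltn_add2l.
  by rewrite expn_gt0 ltnW.
have : (p ^ a.+1 %| p ^ a)%N.
  by rewrite -(dvdn_addl _ (dvdn_exp2l p ab)) e dvdn_exp2l.
by rewrite dvdn_Pexp2l // ltnn.
Qed.

(** The exponents are the eight subset sums of Q, R, S; for positive values, two agree only if two
    of Q, R, S are equal or one is the sum of the others. *)
Lemma C1_exps_uniq Q R S : [/\ 0 < Q, 0 < R & 0 < S]%N ->
    [/\ Q <> R, Q <> S & R <> S] ->
    [/\ Q + R <> S, Q + S <> R & R + S <> Q]%N ->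
  uniq [seq m.2 | m <- C1_exps Q R S].
Proof.
move=> [Q0 R0 S0] [QR QS RS] [nS nR nQ].
by rewrite /C1_exps /= !inE; lia.
Qed.

(** * Roots of unity and the permutation criterion on mu *)

Lemma expr_coprime_eq1 (F : fieldType) (t : F) m n : (0 < n)%N ->
  coprime m n -> t ^+ m = 1 -> t ^+ n = 1 -> t = 1.
Proof.
move=> n0 /eqP mn tm tn; have [d td dn] := prim_order_exists n0 tn.
have dm : (d %| m)%N by rewrite (prim_order_dvd td) tm.
have : (d %| 1)%N by rewrite -mn dvdn_gcd dm.
by rewrite dvdn1 => /eqP d1; rewrite -[t]expr1 -d1 (prim_expr_order td).
Qed.

Lemma expr_coprime_inj (F : fieldType) (x y : F) m n : (0 < n)%N -> y != 0 ->
  coprime m n -> x ^+ m = y ^+ m -> x ^+ n = y ^+ n -> x = y.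
Proof.
move=> n0 y0 mn xm xn; apply: (divIf y0); rewrite divff //.
by apply: (expr_coprime_eq1 n0 mn); rewrite expr_div_n ?xm ?xn divff ?expf_neq0.
Qed.

Section Permutation.

Variables (F : finFieldType) (q : nat).
Hypotheses (cardF : #|F| = (q ^ 2)%N) (q_gt1 : (1 < q)%N).

Definition mu : pred F := [pred x | x ^+ (q + 1) == 1].

Lemma expf_pred_card (x : F) : x != 0 -> x ^+ #|F|.-1 = 1.
Proof.
move=> x0; apply: (mulfI x0); rewrite -exprS prednK ?mulr1 ?expf_card //.
by rewrite cardF expn_gt0 ltnW.
Qed.

Lemma exists_prim_root n :
  (n %| #|F|.-1)%N -> exists z : F, n.-primitive_root z.
Proof.
have F0 : (0 < #|F|.-1)%N by rewrite cardF; nia.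
have : has #|F|.-1.-primitive_root [seq x <- enum F | x != 0 :> F].
  apply: has_prim_root => //.
  - apply/allP=> x; rewrite mem_filter => /andP[x0 _].
    by apply/unity_rootP; apply: expf_pred_card.
  - by rewrite filter_uniq // enum_uniq.
  rewrite size_filter (eq_count (a2 := predC (pred1 0))) //.
  rewrite -(leq_add2l 1) add1n prednK; last by rewrite cardF expn_gt0 ltnW.
  rewrite cardE -(count_predC (pred1 0)) leq_add2r.
  by rewrite count_uniq_mem ?enum_uniq // leq_b1.
by case/hasP=> z _ zP nF; exists (z ^+ (#|F|.-1 %/ n)); apply: dvdn_prim_root.
Qed.

Lemma pred_cardM : #|F|.-1 = ((q - 1) * (q + 1))%N.
Proof. by rewrite cardF; nia. Qed.

(** Write x as the i-th power of a generator: being in mu forces q - 1 to divide i. *)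
Lemma mu_expP x : x \in mu -> exists2 a : F, a != 0 & a ^+ (q - 1) = x.
Proof.
rewrite inE => /eqP x1; have [g gP] := exists_prim_root (dvdnn _).
have /(prim_rootP gP)[[i _] /= xi] : x ^+ #|F|.-1 = 1.
  by rewrite pred_cardM mulnC exprM x1 expr1n.
have : (#|F|.-1 %| i * (q + 1))%N by rewrite (prim_order_dvd gP) exprM -xi x1.
rewrite pred_cardM dvdn_pmul2r ?addn1 // => qi.
exists (g ^+ (i %/ (q - 1))); last by rewrite -exprM divnK.
apply/expf_neq0/eqP => g0; have /eqP := prim_expr_order gP.
rewrite g0 expr0n pred_cardM muln_eq0 subn_eq0 leqNgt q_gt1 addn1.
by rewrite eq_sym oner_eq0.
Qed.

Lemma mu_neq0 x : x \in mu -> x != 0.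
Proof.
by apply: contraTneq => ->; rewrite inE expr0n addn1 eq_sym oner_eq0.
Qed.

Lemma mu_expXr x i : x \in mu -> x ^+ i \in mu.
Proof. by rewrite !inE exprAC => /eqP->; rewrite expr1n. Qed.

Lemma mu_exp_inj m :
  {in mu &, injective (fun x : F => x ^+ m)} <-> coprime m (q + 1).
Proof.
split=> [inj_m|m_co x y xmu ymu /= exy]; last first.
  apply: (expr_coprime_inj _ (mu_neq0 ymu) m_co exy); first by rewrite addn1.
  by move: xmu ymu; rewrite !inE => /eqP-> /eqP->.
(* Such a root lies in mu and has the same m-th power as 1. *)
have [|z zP] := @exists_prim_root (gcdn m (q + 1)).
  by rewrite pred_cardM dvdn_mull ?dvdn_gcdr.
have zmu : z \in mu.
  by rewrite inE -(prim_order_dvd zP) dvdn_gcdr.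
have z1 : z = 1.
  apply: inj_m => //=; first by rewrite inE expr1n.
  by rewrite expr1n; apply/eqP; rewrite -(prim_order_dvd zP) dvdn_gcdl.
by rewrite /coprime -dvdn1 (prim_order_dvd zP) z1 expr1n.
Qed.

(** The map a -> a^(q-1) carries f to g(x) = x^r h(x)^(q-1) on mu. On its fibres, the cosets of the
    (q-1)-st roots of unity u, f(u a) = u^r f(a). *)
Lemma permutes_mu r (h : {poly F}) : (0 < r)%N ->
    {in mu, forall x, h.[x] != 0} ->
  permutes ('X^r * (h \Po 'X^(q - 1))) <->
    coprime r (q - 1) /\
    {in mu &, injective (fun x => x ^+ r * h.[x] ^+ (q - 1))}.
Proof.
move=> r0 h0; have q10 : (0 < q - 1)%N by rewrite subn_gt0.
have fE x : ('X^r * (h \Po 'X^(q - 1))).[x] = x ^+ r * h.[x ^+ (q - 1)].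
  by rewrite hornerM horner_comp !hornerXn.
have powmu (x : F) : x != 0 -> x ^+ (q - 1) \in mu.
  by move=> x0; rewrite inE -exprM -pred_cardM expf_pred_card.
split=> [/bij_inj f_inj|[r_co g_inj]].
  have r_co : coprime r (q - 1).
    have [|z zP] := @exists_prim_root (gcdn r (q - 1)).
      by rewrite pred_cardM dvdn_mulr ?dvdn_gcdr.
    have z1 : z = 1.
      apply: f_inj; rewrite !fE !expr1n; have dvdz := prim_order_dvd zP.
      have /eqP-> : z ^+ r == 1 by rewrite -dvdz dvdn_gcdl.
      by have /eqP-> : z ^+ (q - 1) == 1 by rewrite -dvdz dvdn_gcdr.
    by rewrite /coprime -dvdn1 (prim_order_dvd zP) z1 expr1n.
  split=> // _ _ /mu_expP[a a0 <-] /mu_expP[b b0 <-] eg.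
  have fn0 c : c != 0 -> c ^+ r * h.[c ^+ (q - 1)] != 0.
    by move=> c0; rewrite mulf_neq0 ?expf_neq0 ?h0 ?powmu.
  pose c := (a ^+ r * h.[a ^+ (q - 1)]) / (b ^+ r * h.[b ^+ (q - 1)]).
  have c1 : c ^+ (q - 1) = 1.
    rewrite expr_div_n !exprMn ![_ ^+ r ^+ _]exprAC eg divff //.
    by rewrite mulf_neq0 ?expf_neq0 ?h0 ?powmu.
  (* Bezout gives v with 1 + v r divisible by q - 1, so c^(-v) is an r-th root of c. *)
  have [u u1 uc] : exists2 u, u ^+ (q - 1) = 1 & u ^+ r = c.
    have [v _ /dvdnP[k ek]] := Bezoutr r q10.
    exists (c ^- v); first by rewrite -exprVn exprAC exprVn c1 invr1 expr1n.
    rewrite -[RHS]mul1r -exprVn -exprM; apply: (mulfI (x := c ^+ (v * r))).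
      by rewrite expf_neq0 // mulf_neq0 ?invr_eq0 ?fn0.
    rewrite -exprMn divff ?expr1n ?mul1r; last first.
      by rewrite mulf_neq0 ?invr_eq0 ?fn0.
    move/eqP: r_co ek => -> ek.
    by rewrite -exprSr -add1n ek mulnC exprM c1 expr1n.
  have -> : a = u * b; last by rewrite exprMn u1 mul1r.
  apply: f_inj; rewrite !fE !exprMn u1 uc mul1r -mulrA divfK //.
  exact: fn0.
apply: injF_bij => x y; rewrite !fE.
(* The only root of f is 0. *)
have z0 t : t ^+ r * h.[t ^+ (q - 1)] = 0 -> t = 0.
  move=> /eqP; rewrite mulf_eq0 expf_eq0 r0 /= => /orP[/eqP//|].
  by case: (eqVneq t 0) => // /powmu/h0/negPf->.
have [-> e|y0] := eqVneq y 0.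
  by apply: z0; rewrite e expr0n gtn_eqF // mul0r.
have [-> e|x0 e] := eqVneq x 0.
  by apply/esym/z0; rewrite -e expr0n gtn_eqF // mul0r.
have exy : x ^+ (q - 1) = y ^+ (q - 1).
  apply: g_inj; rewrite ?powmu // ![_ ^+ (q - 1) ^+ r]exprAC -!exprMn.
  by rewrite e.
apply: (expr_coprime_inj q10 y0 r_co _ exy).
by move: e; rewrite exy; apply: mulIf; rewrite h0 ?powmu.
Qed.

End Permutation.

(** * Values of C1 and C2 as combinations of two products *)

Section Evaluation.

Variables (F : fieldType) (w : F) (Q R S : nat).
Hypotheses (pQ : [pchar F].-nat Q) (pR : [pchar F].-nat R)
  (pS : [pchar F].-nat S).

Definition numer (x : F) := (w * x + 1) ^+ Q * (x + w) ^+ R * (w * x + 1) ^+ S.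
Definition denom (x : F) := (x + w) ^+ Q * (w * x + 1) ^+ R * (x + w) ^+ S.

Lemma horner_C1 x : (C1 w Q R S).[x] = numer x - w * denom x.
Proof.
rewrite /C1 /numer /denom !(hornerD, hornerZ, hornerXn, hornerC).
rewrite !exprDn_pchar // !exprMn !expr1n.
by rewrite !exprD !expr1; ring.
Qed.

(** Replacing x by 1/x exchanges w x + 1 and x + w up to the factor 1/x, which [x ^+ (Q + R + S)]
    absorbs. *)
Lemma horner_C2 x : x != 0 -> (C2 w Q R S).[x] = denom x - w * numer x.
Proof.
move=> x0; have sC := size_C1 w Q R S.
have := recip_polyE idfun sC x0; rewrite !map_poly_id // => ->.
rewrite horner_C1 /numer /denom !exprD.
have -> : w * x^-1 + 1 = (x + w) / x by field.
have -> : x^-1 + w = (w * x + 1) / x by field.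
rewrite !expr_div_n; field.
by rewrite !expf_neq0.
Qed.

End Evaluation.

(** * The case q = 1 mod 3: conjugation to a power map on mu *)

Section ResidueOne.

Variables (F : finFieldType) (q : nat) (w : F).
Hypotheses (pq : [pchar F].-nat q) (w3 : 3.-primitive_root w)
  (q_mod3 : q = 1 %[mod 3]).

Local Notation mu := (@mu F q).

Lemma w_expq : w ^+ q = w.
Proof. by rewrite (expr3n_eq w3 q_mod3). Qed.

Lemma w_sqr_neq1 : w ^+ 2 != 1.
Proof. by rewrite -(prim_order_dvd w3). Qed.

Lemma mu_expq x : x \in mu -> x ^+ q = x^-1.
Proof.
move=> xmu; apply: (mulIf (mu_neq0 xmu)).
rewrite mulVf ?(mu_neq0 xmu) //.
by move: xmu; rewrite inE exprD => /eqP.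
Qed.

Lemma mu_expq_inv x : x != 0 -> x ^+ q = x^-1 -> x \in mu.
Proof. by move=> x0 xq; rewrite inE exprD xq mulVf. Qed.

Lemma frobB (a b : F) : (a - b) ^+ q = a ^+ q - b ^+ q.
Proof. by rewrite exprDn_pchar // exprNn_pchar. Qed.

Lemma w_notin_mu : w \notin mu.
Proof. by rewrite inE exprD w_expq -expr2 w_sqr_neq1. Qed.

(** The q-th power map fixes [w] and inverts elements of mu, hence it exchanges w x + 1 and x + w up
    to 1/x. *)
Lemma psi_num_expq x : x \in mu -> (w * x + 1) ^+ q = (x + w) / x.
Proof.
move=> xmu; rewrite exprDn_pchar // exprMn w_expq mu_expq // expr1n.
by field; rewrite (mu_neq0 xmu).
Qed.

Lemma psi_den_expq x : x \in mu -> (x + w) ^+ q = (w * x + 1) / x.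
Proof.
move=> xmu; rewrite exprDn_pchar // w_expq mu_expq //.
by field; rewrite (mu_neq0 xmu).
Qed.

Let q_gt0 : (0 < q)%N. Proof. by case: (q) q_mod3. Qed.

(** By the exchange under q-th powers the two factors vanish together, and a common zero would give
    w^2 = 1. *)
Lemma psi_num_den_neq0 x : x \in mu -> w * x + 1 != 0 /\ x + w != 0.
Proof.
move=> xmu; have x0 := mu_neq0 xmu.
have eN := psi_num_expq xmu; have eD := psi_den_expq xmu.
have eqND : (w * x + 1 == 0) = (x + w == 0).
  have := expf_eq0 (w * x + 1) q; rewrite q_gt0 eN /= => <-.
  by rewrite mulf_eq0 invr_eq0 (negPf x0) orbF.
suff D0 : x + w != 0 by rewrite eqND.
apply: contraNneq w_sqr_neq1 => D0.
move/eqP: D0 (D0); rewrite -eqND => /eqP N0 /eqP; rewrite addr_eq0 => /eqP xw.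
by apply/eqP; move: N0; rewrite xw mulrN addrC => /subr0_eq.
Qed.

Definition psi (x : F) := (w * x + 1) / (x + w).
(** The inverse Möbius transformation of [psi]. *)
Definition sigma (y : F) := (1 - w * y) / (y - w).

Lemma psi_mu x : x \in mu -> psi x \in mu.
Proof.
move=> xmu; have [N0 D0] := psi_num_den_neq0 xmu.
apply: mu_expq_inv; first by rewrite mulf_neq0 ?invr_eq0.
rewrite /psi expr_div_n psi_num_expq // psi_den_expq //.
by field; rewrite N0 D0 (mu_neq0 xmu).
Qed.

Lemma sigma_den_neq0 y : y \in mu -> y - w != 0.
Proof.
by apply: contraTneq => /eqP; rewrite subr_eq0 => /eqP->; exact: w_notin_mu.
Qed.

Lemma sigma_den_expq y : y \in mu -> (y - w) ^+ q = (1 - w * y) / y.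
Proof.
move=> ymu; rewrite frobB w_expq mu_expq //.
by field; rewrite (mu_neq0 ymu).
Qed.

Lemma sigma_num_neq0 y : y \in mu -> 1 - w * y != 0.
Proof.
move=> ymu; have : (y - w) ^+ q != 0 by rewrite expf_neq0 ?sigma_den_neq0.
by rewrite sigma_den_expq // mulf_eq0 negb_or => /andP[].
Qed.

Lemma sigma_mu y : y \in mu -> sigma y \in mu.
Proof.
move=> ymu; have N0 := sigma_num_neq0 ymu; have D0 := sigma_den_neq0 ymu.
apply: mu_expq_inv; first by rewrite mulf_neq0 ?invr_eq0.
rewrite /sigma expr_div_n sigma_den_expq // frobB exprMn expr1n w_expq.
rewrite mu_expq //.
by field; rewrite N0 D0 (mu_neq0 ymu).
Qed.

Let w2 : 1 - w ^+ 2 != 0.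
Proof. by rewrite subr_eq0 eq_sym w_sqr_neq1. Qed.

Lemma sigmaK y : y \in mu -> psi (sigma y) = y.
Proof.
move=> ymu; have D0 := sigma_den_neq0 ymu; rewrite /psi /sigma; field.
rewrite D0 /=; apply: contraNneq w2 => e; apply/eqP; rewrite -e; ring.
Qed.

Lemma sigma_inj : {in mu &, injective sigma}.
Proof. by move=> x y xmu ymu e; rewrite -[x]sigmaK // e sigmaK. Qed.

(** Both [psi] and [sigma] preserve mu and are injective there, so neither they nor [tau] affect
    injectivity. *)
Lemma mu_map_inj (g : F -> F) m (tau : F -> F) : injective tau ->
    {in mu, forall x, g x = tau (sigma (psi x ^+ m))} ->
  {in mu &, injective g} <-> {in mu &, injective (fun x : F => x ^+ m)}.
Proof.
move=> tau_inj gE; split=> [g_inj x y xmu ymu /= e|m_inj x y xmu ymu].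
  rewrite -[x]sigmaK // -[y]sigmaK //; congr psi.
  by apply: g_inj; rewrite ?gE ?sigma_mu // !sigmaK // e.
rewrite !gE // => /tau_inj/sigma_inj e.
have {}e : psi x = psi y.
  by apply: m_inj; rewrite ?psi_mu // e // mu_expXr // psi_mu.
(* Injectivity of [psi]: cross-multiplying psi x = psi y leaves (w^2 - 1)(x - y) = 0. *)
have [_ D0] := psi_num_den_neq0 xmu; have [_ D0'] := psi_num_den_neq0 ymu.
apply/(mulfI w2)/subr0_eq.
move/eqP: e; rewrite /psi eqr_div // -subr_eq0 => e.
by rewrite -[RHS]oppr0 -(eqP e); ring.
Qed.

Section Conjugation.

Variables Q R S : nat.
Hypotheses (pQ : [pchar F].-nat Q) (pR : [pchar F].-nat R)
  (pS : [pchar F].-nat S).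

(* On mu, [y ^- R = y ^+ (q * R)]: the natural exponent [Q + S + q * R] stands
   for the possibly negative integer Q - R + S. *)
Lemma psi_exp x : x \in mu ->
  psi x ^+ (Q + S + q * R) = numer w Q R S x / denom w Q R S x.
Proof.
move=> xmu; have [N0 D0] := psi_num_den_neq0 xmu.
rewrite !exprD exprM mu_expq ?psi_mu // /numer /denom /psi invf_div.
rewrite !expr_div_n; field.
by rewrite !expf_neq0.
Qed.

Lemma numer_expq x : x \in mu ->
  numer w Q R S x ^+ q = denom w Q R S x / x ^+ (Q + R + S).
Proof.
move=> xmu; rewrite /numer /denom !exprMn ![_ ^+ _ ^+ q]exprAC.
rewrite psi_num_expq // psi_den_expq // !expr_div_n !exprD.
by field; rewrite !expf_neq0 ?(mu_neq0 xmu).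
Qed.

Lemma denom_expq x : x \in mu ->
  denom w Q R S x ^+ q = numer w Q R S x / x ^+ (Q + R + S).
Proof.
move=> xmu; rewrite /numer /denom !exprMn ![_ ^+ _ ^+ q]exprAC.
rewrite psi_num_expq // psi_den_expq // !expr_div_n !exprD.
by field; rewrite !expf_neq0 ?(mu_neq0 xmu).
Qed.

(** With d the value of [denom] and T the power of psi x, C1 = d (T - w) and C2 = d (1 - w T); as T
    is in mu, neither factor vanishes. *)
Lemma C12_sigma x : x \in mu ->
  [/\ (C1 w Q R S).[x] != 0, (C2 w Q R S).[x] != 0
    & (C2 w Q R S).[x] / (C1 w Q R S).[x] = sigma (psi x ^+ (Q + S + q * R))].
Proof.
move=> xmu; have x0 := mu_neq0 xmu; have [N0 D0] := psi_num_den_neq0 xmu.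
have Tmu := mu_expXr (Q + S + q * R) (psi_mu xmu).
have := sigma_num_neq0 Tmu; have := sigma_den_neq0 Tmu.
rewrite /sigma psi_exp // horner_C1 // horner_C2 //.
have : denom w Q R S x != 0 by rewrite !mulf_neq0 ?expf_neq0.
move: (numer _ _ _ _ _) (denom _ _ _ _ _) => n d d0.
have -> : n / d - w = (n - w * d) / d by field.
have -> : 1 - w * (n / d) = (d - w * n) / d by field.
rewrite !mulf_eq0 !invr_eq0 !negb_or d0 !andbT => C10 C20; split=> //.
by field; rewrite d0 C10.
Qed.

(** Thus C1^(q-1) is C2 / C1 up to a power of x that x^r cancels, and symmetrically for C2. *)
Lemma C12_expq x : x \in mu ->
  (C1 w Q R S).[x] ^+ q = (C2 w Q R S).[x] / x ^+ (Q + R + S) /\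
  (C2 w Q R S).[x] ^+ q = (C1 w Q R S).[x] / x ^+ (Q + R + S).
Proof.
move=> xmu; have x0 := mu_neq0 xmu.
rewrite horner_C1 // horner_C2 // !frobB ![(w * _) ^+ q]exprMn w_expq.
rewrite numer_expq // denom_expq //.
by split; rewrite mulrBl mulrA.
Qed.

(** Hence scaling by 1/beta disappears in a (q-1)-st power. *)
Lemma beta_expq : beta w Q R S ^+ q = beta w Q R S.
Proof. by rewrite beta_diff frobB ![_ ^+ _ ^+ q]exprAC w_expq. Qed.

(* The function [tau] is the identity for C1 and the inversion for C2. *)
Lemma mu_map_sigma r C : C = C1 w Q R S \/ C = C2 w Q R S ->
    beta w Q R S != 0 -> r = Q + R + S %[mod q + 1] ->
  exists2 tau : F -> F, injective tau &
    {in mu, forall x, ((beta w Q R S)^-1 *: C).[x] != 0 /\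
      x ^+ r * ((beta w Q R S)^-1 *: C).[x] ^+ (q - 1)
      = tau (sigma (psi x ^+ (Q + S + q * R)))}.
Proof.
move=> defC b0 r_mod.
have xr x : x \in mu -> x ^+ r = x ^+ (Q + R + S).
  by move=> /eqP x1; rewrite -(expr_mod _ x1) r_mod expr_mod.
have bq c : c != 0 ->
    ((beta w Q R S)^-1 * c) ^+ (q - 1) = c ^+ q / c.
  move=> c0; have bc0 : (beta w Q R S)^-1 * c != 0.
    by rewrite mulf_neq0 ?invr_eq0.
  apply: (mulIf bc0); rewrite -exprSr subn1 prednK //.
  by rewrite exprMn exprVn beta_expq; field; rewrite b0 c0.
have [->|->] := defC;
  [exists id | exists GRing.inv; first exact: invr_inj] => // x xmu;
  have [C10 C20 <-] := C12_sigma xmu; have [e1 e2] := C12_expq xmu;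
  have x0 := expf_neq0 (Q + R + S) (mu_neq0 xmu);
  rewrite hornerZ bq // xr // ?e1 ?e2 mulf_neq0 ?invr_eq0 //; split=> //;
  by field; rewrite ?x0 ?C10 ?C20.
Qed.

End Conjugation.

End ResidueOne.

(** The q-th power map is odd in every characteristic, so (-w)^(q+1) = w^(q+1), and 3 divides q +
    1. *)
Lemma minus_root3_mu (F : finFieldType) (q : nat) (w : F) :
  [pchar F].-nat q -> 3.-primitive_root w -> (q %% 3 = 2)%N -> - w \in mu q.
Proof.
move=> pq w3 q2; rewrite inE addn1 exprS exprNn_pchar // mulrNN -exprS.
by rewrite -(prim_order_dvd w3); lia.
Qed.

(** * Assembly of (i) and (ii) *)

Theorem theorem1p3 (p k q Q R S r : nat) (F : finFieldType) (w : F)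
    (p_prime : prime p) (p_neq3 : p <> 3%N)
    (k_gt0 : (0 < k)%N) (def_q : q = (p ^ k)%N)
    (Q_pow : exists i : nat, Q = (p ^ i)%N)
    (R_pow : exists i : nat, R = (p ^ i)%N)
    (S_pow : exists i : nat, S = (p ^ i)%N)
    (cardF : #|F| = (q ^ 2)%N)
    (w_order3 : 3.-primitive_root w)
    (r_gt0 : (0 < r)%N)
    (r_mod : r = Q + R + S %[mod q + 1]) :
  forall C : {poly F}, C = C1 w Q R S \/ C = C2 w Q R S ->
  let B := (beta w Q R S)^-1 *: C in
  let f := 'X^r * (B \Po 'X^(q - 1)) in
  [/\ (nb_terms B <= 5)%N,
      forall i : nat, in_prime_field p B`_i
    & Q <> R /\ Q <> S /\ R <> S ->
      forall i : nat, B`_i != 0 -> B`_i = 1 \/ B`_i = -1]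
  /\
  (permutes f <->
     [/\ q = 1 %[mod 3],
         gcdn r (q - 1) = 1%N
       & gcdz (Q%:Z - R%:Z + S%:Z) (q%:Z + 1) = 1]).
Proof.
move=> C defC B f.
have pF : p \in [pchar F].
  by apply: (@card_finPcharP F p (k * 2)) => //; rewrite cardF def_q expnM.
have pnat i : [pchar F].-nat (p ^ i)%N.
  by rewrite pnatX (eq_pnat _ (pcharf_eq pF)) pnat_id.
have pow3 i : ~~ (3 %| p ^ i)%N.
  rewrite Euclid_dvdX // dvdn_prime2 //; apply/nandP; left.
  by apply/eqP => e; apply: p_neq3.
have q1 : (1 < q)%N by rewrite def_q -(expn0 p) ltn_exp2l ?prime_gt1.
have pq : [pchar F].-nat q by rewrite def_q.
have q3 : ~~ (3 %| q)%N by rewrite def_q.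
have [iQ eQ] := Q_pow; have [iR eR] := R_pow; have [iS eS] := S_pow.
have [pQ pR pS] : [/\ [pchar F].-nat Q, [pchar F].-nat R & [pchar F].-nat S].
  by rewrite eQ eR eS.
have [Q3 R3 S3] : [/\ ~~ (3 %| Q), ~~ (3 %| R) & ~~ (3 %| S)]%N.
  by rewrite eQ eR eS.
have b0 := beta_neq0 w_order3 Q3 R3 S3.
split.
  (* C1 and C2 share their coefficients; only the exponents are reflected. *)
  have [L [defL Lb cL uL]] : exists L, [/\ C = poly_of_terms L,
      forall m, m \in L ->
        [\/ m.1 = 0, m.1 = beta w Q R S | m.1 = - beta w Q R S],
      count (fun m => m.1 != 0)%R L = 5%N
    & uniq [seq m.2 | m <- C1_exps Q R S] -> uniq [seq m.2 | m <- L]].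
    have [->|->] := defC.
      exists (map (diff_term w) (C1_exps Q R S)).
      split; rewrite ?C1_terms // ?count_map -?map_comp //.
        by move=> _ /mapP[m /(C1_coef w_order3 Q3 R3 S3) ? ->].
      exact: C1_exps_count.
    exists [seq ((diff_term w m).1, (Q + R + S - m.2)%N) | m <- C1_exps Q R S].
    split; rewrite ?C2_terms // ?count_map -?map_comp //.
    - by move=> _ /mapP[m /(C1_coef w_order3 Q3 R3 S3) ? ->].
    - exact: C1_exps_count.
    (* Truncated subtraction from Q + R + S is injective because no exponent exceeds it. *)
    move=> u; rewrite (map_comp (fun e => Q + R + S - e)%N snd).
    rewrite map_inj_in_uniq //.
    have le_e e : e \in [seq m.2 | m <- C1_exps Q R S] -> (e <= Q + R + S)%N.
      by rewrite /C1_exps /= !inE; lia.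
    by move=> e e' /le_e ? /le_e ?; lia.
  have [nB BF B1] := scaled_terms b0 Lb; rewrite -defL -/B in nB BF B1.
  split; first by rewrite -cL.
  - exact: BF.
  move=> [QR [QS RS]]; apply: B1; apply: uL.
  apply: C1_exps_uniq => //.
    by rewrite eQ eR eS !expn_gt0 prime_gt0.
  move: QR QS RS; rewrite eQ eR eS => QR QS RS.
  by split; apply: prime_pow_add_neq.
have [q_mod3|q_mod3] : q = 1 %[mod 3] \/ (q %% 3 = 2)%N by lia.
  have [tau tau_inj tauE] :=
    mu_map_sigma pq w_order3 q_mod3 pQ pR pS defC b0 r_mod.
  have crit := permutes_mu cardF q1 r_gt0 (fun x xmu => (tauE x xmu).1).
  have ginj :=
    mu_map_inj pq w_order3 q_mod3 tau_inj (fun x xmu => (tauE x xmu).2).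
  have minj := mu_exp_inj cardF q1 (Q + S + q * R).
  have gcdE : gcdz (Q%:Z - R%:Z + S%:Z) (q%:Z + 1)
      = gcdn (Q + S + q * R) (q + 1).
    (* Modulo q + 1, -R is congruent to q R. *)
    have -> : Q%:Z - R%:Z + S%:Z = (- R%:Z) * (q%:Z + 1) + (Q + S + q * R)%N%:Z.
      by rewrite !PoszD PoszM; ring.
    by rewrite gcdzC gcdzMDl gcdzC.
  split=> [/crit[/eqP r_co /ginj/minj/eqP m_co]|[_ r_co]].
    by split=> //; rewrite gcdE m_co.
  rewrite gcdE => -[m_co]; apply/crit; split; first by apply/eqP.
  by apply/ginj/minj/eqP.
split=> [/bij_inj f_inj|[]]; last by lia.
have wmu := minus_root3_mu pq w_order3 q_mod3.
(* This nonzero [a] satisfies f(a) = 0 = f(0), since B vanishes at a^(q-1) = -w. *)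
have [a a0 ea] := mu_expP cardF q1 wmu.
have w0 := mu_neq0 wmu.
have [Q0 R0] : (0 < Q)%N /\ (0 < R)%N by rewrite eQ eR !expn_gt0 prime_gt0.
have Cw : C.[- w] = 0.
  have n0 : numer w Q R S (- w) = 0.
    by rewrite /numer addNr [0 ^+ R]expr0n (gtn_eqF R0) mulr0 mul0r.
  have d0 : denom w Q R S (- w) = 0.
    by rewrite /denom addNr [0 ^+ Q]expr0n (gtn_eqF Q0) !mul0r.
  by case: defC => ->; rewrite ?horner_C1 ?horner_C2 // n0 d0 mulr0 subr0.
case/eqP: a0; apply: f_inj.
rewrite /f !hornerM !horner_comp !hornerXn ea /B !hornerZ Cw !mulr0.
by rewrite expr0n (gtn_eqF r_gt0) mul0r.
Qed.
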